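(* Let $\mathcal F=\{f_i(x)=r_ix+b_i\}_{i=1}^m$ be an affine reverse iterated function system on $\mathbb R$, with $r_i,b_i\in\mathbb R$ and $|r_i|>1$ for all $i$. Then $d_{\mathcal F}=s$ if and only if $\mathcal F^{-1}$ has no exact overlaps.
   Context: The maps $f_1,\dots,f_m$ are distinct. For a finite nonempty word $\mathbf i=i_1\cdots i_n$ over $\{1,\dots,m\}$ put $f_{\mathbf i}=f_{i_1}\circ\cdots\circ f_{i_n}$ and $f_{\mathbf i}^{-1}=(f_{\mathbf i})^{-1}$. $G^*(\mathcal F)=\{f_{\mathbf i}\}$ is the semigroup of distinct maps generated by $\mathcal F$, $|g'|$ is the absolute value of the linear coefficient of the affine map $g$, and $$d_{\mathcal F}=\lim_{R\to\infty}\frac{\log\#\{g\in G^*(\mathcal F):|g'|\le R\}}{\log R},$$ a limit which always exists. The similarity dimension $s$ is the unique solution of $\sum_{i=1}^m|r_i|^{-s}=1$. The dual system is $\mathcal F^{-1}=\{f_i^{-1}\}_{i=1}^m$; it has exact overlaps if $f_{\mathbf i}^{-1}=f_{\mathbf j}^{-1}$ for some distinct finite nonempty words $\mathbf i\ne\mathbf j$ (possibly of different lengths). *)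

(* Defs.v *)
From HB Require Import structures.
From mathcomp Require Import all_boot all_order all_algebra.
From mathcomp Require Import finmap.
From mathcomp Require Import all_classical all_reals all_analysis.

Set Implicit Arguments.
Unset Strict Implicit.
Unset Printing Implicit Defensive.

Import Order.TTheory GRing.Theory Num.Theory.
Import numFieldNormedType.Exports.

Local Open Scope classical_set_scope.
Local Open Scope ring_scope.

Definition affine (R : realType) (a c : R) : R -> R := fun x => a * x + c.

Definition word_map (T : Type) (m : nat) (f : 'I_m -> T -> T)
    (w : seq 'I_m) : T -> T :=
  foldr (fun i g => f i \o g) idfun w.

(* A set of maps: two words inducing the same map contribute one element. *)
Definition semigroup_of (T : Type) (m : nat) (f : 'I_m -> T -> T) :
    set (T -> T) :=
  [set g | exists2 w : seq 'I_m, w <> [::] & g = word_map f w].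

Definition semigroup_ball (R : realType) (m : nat) (f : 'I_m -> R -> R)
    (t : R) : set (R -> R) :=
  [set g | semigroup_of f g /\ exists a c, g = affine a c /\ `|a| <= t].

(* [fset_set] sends infinite sets to the empty set; when the [f i] are affine
   with slopes of absolute value > 1, every [semigroup_ball f t] is finite. *)
Definition growth_count (R : realType) (m : nat) (f : 'I_m -> R -> R)
    (t : R) : nat :=
  #|` fset_set (semigroup_ball f t)|.

(* The limit exists for every system of affine maps with slopes of absolute
   value > 1 (and at least one map), so [lim] is not a default value there. *)
Definition growth_dim (R : realType) (m : nat) (f : 'I_m -> R -> R) : R :=
  lim (ln (growth_count f t)%:R / ln t @[t --> +oo%R]).

Definition is_similarity_dim (R : realType) (m : nat) (r : 'I_m -> R)
    (s : R) : Prop :=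
  \sum_(i < m) `|r i| `^ (- s) = 1.

(* [pinv setT g] is the inverse map of [g] as soon as [g] is a bijection.
   The inverse of a composition is taken as a whole, that is
   f_(i_1 ... i_n)^-1 = f_(i_n)^-1 o ... o f_(i_1)^-1. *)
Definition dual_exact_overlaps (T : pointedType) (m : nat)
    (f : 'I_m -> T -> T) : Prop :=
  exists u v : seq 'I_m,
    [/\ u <> [::], v <> [::], u <> v &
        pinv setT (word_map f u) = pinv setT (word_map f v) :> (T -> T)].

(* Main.v *)
Require Import Defs.
From mathcomp Require Import all_boot all_order all_algebra.
From mathcomp Require Import finmap lra zify.
From mathcomp Require Import all_classical all_reals all_analysis.

Import Order.TTheory GRing.Theory Num.Theory.
Import numFieldNormedType.Exports.
Local Open Scope ring_scope.

(** Write [slope r w] for the linear coefficient of the map of the word [w],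
    and give [w] the weight [|slope r w| ^ (- sigma)].  Weights are
    multiplicative under concatenation, and at [sigma = s] the letters have
    total weight [1].

    Upper bounds for the counting function come from one principle
    ([growth_count_le]): if every map of the semigroup is induced by a word of
    [A^k B] for some [k], where [A] has total weight less than [1] at some
    [sigma >= 0], then a geometric series bounds the counting function at [t]
    by a constant times [t ^ sigma].

    Without exact overlaps, take for [A] the letters and any [sigma > s]: the
    growth exponent is at most [s].  Since distinct words now induce distinct
    maps, the counting function counts words, and the renewal equation for the
    number of words of slope at most [t] bounds that number below by
    [(t ^ s - 1) / m] ([size_filter_words_le_ge]).  Hence the limit exists and
    is [s].

    With an exact overlap there are distinct words [u] and [v] of one length
    [n] with the same map ([same_length_overlap]), so every block [u] may be
    replaced by [v], and [A] may be the set of words of length [n] other than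
    [u].  Its weight at [s] is [1 - |slope r u| ^ (- s) < 1], hence still less
    than [1] at some [sigma < s], and the growth exponent is at most [sigma].
    The value of [lim] on a divergent filter is [0], which differs from [s]
    because an overlap forces [s > 0]; so the limit need not be shown to
    exist in that case. *)

(** * Words, their maps and their slopes *)

(** The linear coefficient of [word_map f w] when [f i] has slope [r i]. *)
Definition slope {R : realType} {m : nat} (r : 'I_m -> R) (w : seq 'I_m) : R :=
  \prod_(i <- w) r i.

Lemma slope_cat {R : realType} {m : nat} (r : 'I_m -> R) (u v : seq 'I_m) :
  slope r (u ++ v) = slope r u * slope r v.
Proof. by rewrite /slope big_cat. Qed.

Lemma slope_neq0 {R : realType} {m : nat} {r : 'I_m -> R} (w : seq 'I_m) :
  (forall i, 1 < `|r i|) -> slope r w != 0.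
Proof.
move=> hr; rewrite prodf_seq_neq0; apply/allP => i _ /=.
by rewrite -normr_gt0 (lt_trans ltr01).
Qed.

Lemma slope_gt1 {R : realType} {m : nat} {r : 'I_m -> R} (w : seq 'I_m) :
  (forall i, 1 < `|r i|) -> w <> [::] -> 1 < `|slope r w|.
Proof.
move=> hr; elim: w => // i [|j w] IH _; first by rewrite /slope big_seq1.
rewrite /slope big_cons normrM mulr_egt1 //; exact: IH.
Qed.

(** A common lower bound for the moduli of the slopes of the generators. *)
Lemma exists_expansion {R : realType} {m : nat} {r : 'I_m -> R} :
  (forall i, 1 < `|r i|) ->
  exists2 rho : R, 1 < rho & forall i, rho <= `|r i|.
Proof.
move=> hr; exists (\big[Num.min/2]_(i < m) `|r i|).
  by elim/big_ind: _ => [|x y hx hy|i _]; rewrite ?ltr1n // lt_min hx.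
by move=> i; rewrite (bigD1 i) //= ge_min lexx.
Qed.

Lemma expansion_le_slope {R : realType} {m : nat} {r : 'I_m -> R} {rho : R}
    (w : seq 'I_m) :
  0 <= rho -> (forall i, rho <= `|r i|) -> rho ^+ size w <= `|slope r w|.
Proof.
move=> rho0 hr; elim: w => [|i w IH]; first by rewrite /slope big_nil normr1.
by rewrite /slope big_cons normrM /= exprS ler_pM // exprn_ge0.
Qed.

(* The powers [rho ^ n = exp (n ln rho) >= 1 + n ln rho] are unbounded. *)
Lemma exists_expr_ge {R : realType} (rho t : R) :
  1 < rho -> exists n : nat, t <= rho ^+ n.
Proof.
move=> rho1; have rho0 : 0 < rho by exact: lt_trans rho1.
have lr : 0 < ln rho by rewrite ln_gt0.
exists (Num.bound `|t / ln rho|).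
set n := Num.bound _.
have : t / ln rho <= n%:R.
  by apply: le_trans (ler_norm _) _; exact: ltW (archi_boundP (normr_ge0 _)).
rewrite ler_pdivrMr // => /le_trans; apply.
rewrite -[rho in _ <= rho ^+ n]lnK // -expRM_natl.
by apply: le_trans (expR_ge1Dx _); rewrite lerDr.
Qed.

(** Only words of bounded length have slope of modulus at most [t]. *)
Lemma size_le_of_slope_le {R : realType} {m : nat} {r : 'I_m -> R} (t : R) :
  (forall i, 1 < `|r i|) ->
  exists L : nat, forall w, `|slope r w| <= t -> (size w <= L)%N.
Proof.
move=> hr; have [rho rho1 hrho] := exists_expansion hr.
have [L tL] := exists_expr_ge rho t rho1; exists L => w wt.
rewrite -(ler_eXn2l rho1); apply: le_trans tL.
apply: le_trans wt; apply: expansion_le_slope => //.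
by apply: ltW; apply: lt_trans rho1.
Qed.

Lemma affine_inj {R : realType} {a c a' c' : R} :
  affine a c = affine a' c' -> a = a'.
Proof.
move=> E; have := congr1 (@^~ 0) E; have := congr1 (@^~ 1) E.
by rewrite /affine !mulr0 !mulr1 !add0r => + cc'; rewrite cc' => /addIr.
Qed.

Lemma word_map_cat {T : Type} {m : nat} (f : 'I_m -> T -> T) (u v : seq 'I_m) :
  word_map f (u ++ v) = word_map f u \o word_map f v.
Proof. by elim: u => //= i u ->. Qed.

Lemma word_map_affine {R : realType} {m : nat} (r b : 'I_m -> R)
    (w : seq 'I_m) :
  exists c, word_map (fun i => affine (r i) (b i)) w = affine (slope r w) c.
Proof.
elim: w => [|i w [c E]].
  exists 0; rewrite /slope big_nil.
  by apply/funext => x; rewrite /affine /= mul1r addr0.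
exists (r i * c + b i); rewrite /= E /slope big_cons.
by apply/funext => x; rewrite /affine /= mulrDr mulrA addrA.
Qed.

Lemma slope_word_map {R : realType} {m : nat} {r b : 'I_m -> R}
    {u v : seq 'I_m} :
  word_map (fun i => affine (r i) (b i)) u =
    word_map (fun i => affine (r i) (b i)) v -> slope r u = slope r v.
Proof.
have [c ->] := word_map_affine r b u; have [d ->] := word_map_affine r b v.
exact: affine_inj.
Qed.

Lemma affine_bij {R : realType} (a c : R) : a != 0 -> bijective (affine a c).
Proof.
move=> a0; exists (fun y => (y - c) / a) => x; rewrite /affine.
  by rewrite addrK mulrAC divff // mul1r.
by rewrite mulrCA divff // mulr1 subrK.
Qed.

Lemma word_map_bij {R : realType} {m : nat} (r b : 'I_m -> R) (w : seq 'I_m) :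
  (forall i, 1 < `|r i|) ->
  bijective (word_map (fun i => affine (r i) (b i)) w).
Proof.
move=> hr; have [c ->] := word_map_affine r b w.
by apply: affine_bij; apply: slope_neq0.
Qed.

(** Since [pinv setT g] is a two-sided inverse of a bijection [g], it
    determines [g]. *)
Lemma pinv_bij_inj {T : pointedType} {g h : T -> T} :
  bijective g -> bijective h -> pinv setT g = pinv setT h -> g = h.
Proof.
move=> bg bh E; apply/funext => x.
have /(_ (g x)) := pinvK (fun=> point) (A := setT) (f := h).
rewrite -[pinv setT h]/('pinv_(fun=> point) setT h) -E pinvKV; last 2 first.
- by move=> y z _ _; apply: bij_inj.
- by rewrite inE.
move=> -> //; rewrite inE; case: bh => k _ kh; exists (k (g x)) => //.
Qed.

(** * Finite sets of words and their weights *)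

(** All concatenations of a word of [A] and a word of [B], with repetitions. *)
Definition cat_words {m : nat} (A B : seq (seq 'I_m)) : seq (seq 'I_m) :=
  [seq u ++ v | u <- A, v <- B].

(** The words of length one. *)
Definition letters (m : nat) : seq (seq 'I_m) := [seq [:: i] | i <- enum 'I_m].

(** The words of length [n], each listed at least once. *)
Definition words_eq (m n : nat) : seq (seq 'I_m) :=
  iter n (cat_words (letters m)) [:: [::]].

(** The words of length at most [n], each listed once. *)
Definition words_le (m n : nat) : seq (seq 'I_m) :=
  iter n (fun W => [::] :: cat_words (letters m) W) [:: [::]].

Lemma cat_lettersP {m : nat} (W : seq (seq 'I_m)) (w : seq 'I_m) :
  (w \in cat_words (letters m) W) =
  if w is _ :: v then v \in W else false.
Proof.
apply/allpairsP/idP => [[[_ v] /= [/mapP[i _ ->] vW ->]] //|].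
case: w => // i v vW; exists ([:: i], v); split => //.
by rewrite /= map_f // mem_enum.
Qed.

Lemma mem_words_eq {m : nat} (n : nat) (w : seq 'I_m) :
  (w \in words_eq m n) = (size w == n).
Proof.
elim: n w => [|n IH] w; first by rewrite /= inE size_eq0.
by rewrite /words_eq iterS cat_lettersP; case: w => //= i w; rewrite IH.
Qed.

Lemma mem_words_le {m : nat} (n : nat) (w : seq 'I_m) :
  (w \in words_le m n) = (size w <= n)%N.
Proof.
elim: n w => [|n IH] w; first by rewrite /= inE leqn0 size_eq0.
by rewrite /words_le iterS inE cat_lettersP; case: w => //= i w; rewrite IH.
Qed.

Lemma uniq_words_le (m n : nat) : uniq (words_le m n).
Proof.
elim: n => // n IH; rewrite /words_le iterS cons_uniq cat_lettersP /=.
apply: allpairs_uniq => //.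
  by rewrite map_inj_uniq ?enum_uniq // => i j [].
move=> [x v] [y v'] /allpairsP[[a a'] /= [/mapP[i _ ->] _ [-> _]]].
by move=> /allpairsP[[c c'] /= [/mapP[j _ ->] _ [-> _]]] [-> ->].
Qed.

(** The weight of a list of words, at exponent [sigma]. *)
Definition weight {R : realType} {m : nat} (r : 'I_m -> R) (sigma : R)
    (A : seq (seq 'I_m)) : R :=
  \sum_(w <- A) `|slope r w| `^ (- sigma).

Lemma weight_ge0 {R : realType} {m : nat} (r : 'I_m -> R) (sigma : R)
    (A : seq (seq 'I_m)) : 0 <= weight r sigma A.
Proof. by apply: sumr_ge0 => w _; apply: powR_ge0. Qed.

Lemma weight_cat_words {R : realType} {m : nat} (r : 'I_m -> R) (sigma : R)
    (A B : seq (seq 'I_m)) :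
  weight r sigma (cat_words A B) = weight r sigma A * weight r sigma B.
Proof.
rewrite /weight big_allpairs_dep mulr_suml; apply: eq_bigr => u _.
by rewrite mulr_sumr; apply: eq_bigr => v _; rewrite slope_cat normrM powRM.
Qed.

Lemma weight_iter {R : realType} {m : nat} (r : 'I_m -> R) (sigma : R)
    (A B : seq (seq 'I_m)) (k : nat) :
  weight r sigma (iter k (cat_words A) B) =
  weight r sigma A ^+ k * weight r sigma B.
Proof.
by elim: k => [|k IH]; rewrite ?mul1r // iterS weight_cat_words IH exprS mulrA.
Qed.

Lemma weight_letters {R : realType} {m : nat} (r : 'I_m -> R) (sigma : R) :
  weight r sigma (letters m) = \sum_(i < m) `|r i| `^ (- sigma).
Proof.
rewrite /weight big_map big_enum /=.
by apply: eq_bigr => i _; rewrite /slope big_seq1.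
Qed.

Lemma weight_words_eq {R : realType} {m : nat} (r : 'I_m -> R) (sigma : R)
    (n : nat) :
  weight r sigma (words_eq m n) = weight r sigma (letters m) ^+ n.
Proof.
rewrite weight_iter /weight big_seq1 /slope big_nil.
by rewrite normr1 powR1 mulr1.
Qed.

Lemma weight_mem {R : realType} {m : nat} (r : 'I_m -> R) (sigma : R)
    (A : seq (seq 'I_m)) (w : seq 'I_m) :
  w \in A -> `|slope r w| `^ (- sigma) <= weight r sigma A.
Proof.
move=> wA; rewrite /weight (big_rem w) //= lerDl.
exact: weight_ge0.
Qed.

Lemma weight_rem {R : realType} {m : nat} (r : 'I_m -> R) (sigma : R)
    (A : seq (seq 'I_m)) (w : seq 'I_m) :
  w \in A ->
  weight r sigma (rem w A) = weight r sigma A - `|slope r w| `^ (- sigma).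
Proof. by move=> wA; rewrite /weight (big_rem w wA) /= addrC addrK. Qed.

Lemma weight_continuous {R : realType} {m : nat} (r : 'I_m -> R)
    (A : seq (seq 'I_m)) :
  (forall i, 1 < `|r i|) -> continuous (fun sigma => weight r sigma A).
Proof.
move=> hr s; elim: A => [|w A IH].
  by under eq_fun do rewrite /weight big_nil; apply: cvg_cst.
have w0 : 0 < `|slope r w| by rewrite normr_gt0 slope_neq0.
have -> : (fun sigma => weight r sigma (w :: A)) =
    (fun sigma => expR (- sigma * ln `|slope r w|) + weight r sigma A).
  by apply/funext => x; rewrite /weight big_cons /powR gt_eqF.
apply: cvgD; last exact: IH.
apply: cvg_comp; last exact: continuous_expR.
by apply: cvgM; [apply: cvgN; apply: cvg_id | apply: cvg_cst].
Qed.

(** * Bounds on the growth count *)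

Lemma semigroup_ballP {R : realType} {m : nat} {r b : 'I_m -> R} {t : R}
    {g : R -> R} :
  semigroup_ball (fun i => affine (r i) (b i)) t g <->
  exists w, [/\ w <> [::], `|slope r w| <= t &
                g = word_map (fun i => affine (r i) (b i)) w].
Proof.
split=> [[[w w0 gE] [a [c [gac at_]]]]|[w [w0 wt ->]]].
  exists w; split => //.
  have [d wE] := word_map_affine r b w.
  by move: gac; rewrite gE wE => /affine_inj ->.
split; first by exists w.
by have [d wE] := word_map_affine r b w; exists (slope r w), d.
Qed.

Lemma semigroup_ball_finite {R : realType} {m : nat} {r b : 'I_m -> R} (t : R) :
  (forall i, 1 < `|r i|) ->
  finite_set (semigroup_ball (fun i => affine (r i) (b i)) t).
Proof.
move=> hr; have [L hL] := size_le_of_slope_le t hr.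
apply: sub_finite_set
  (finite_seq (map (word_map (fun i => affine (r i) (b i))) (words_le m L))).
move=> g /semigroup_ballP[w [_ wt ->]] /=.
by apply: map_f; rewrite mem_words_le hL.
Qed.

Lemma growth_count_ge_size {R : realType} {m : nat} {r b : 'I_m -> R} (t : R)
    (W : seq (seq 'I_m)) :
  (forall i, 1 < `|r i|) -> uniq W ->
  (forall w, w \in W -> w <> [::] /\ `|slope r w| <= t) ->
  {in W &, injective (word_map (fun i => affine (r i) (b i)))} ->
  (size W <= growth_count (fun i => affine (r i) (b i)) t)%N.
Proof.
move=> hr uW hW injW.
rewrite -(size_map (word_map (fun i => affine (r i) (b i)))) /growth_count.
apply: uniq_leq_size; first by rewrite map_inj_in_uniq.
move=> _ /mapP[w /hW[w0 wt] ->].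
rewrite in_fset_set ?inE; last exact: semigroup_ball_finite.
by apply/semigroup_ballP; exists w.
Qed.

Lemma growth_count_gt0 {R : realType} {m : nat} {r b : 'I_m -> R} (i : 'I_m)
    (t : R) :
  (forall i, 1 < `|r i|) -> `|r i| <= t ->
  (0 < growth_count (fun i => affine (r i) (b i)) t)%N.
Proof.
move=> hr it; apply: (growth_count_ge_size _ [:: [:: i]]) => //.
  by move=> w; rewrite inE => /eqP ->; rewrite /slope big_seq1.
by move=> u v; rewrite !inE => /eqP -> /eqP ->.
Qed.

(** For [sigma >= 0], each word of [W] of slope at most [t] in modulus
    contributes at least [1] to [t ^ sigma] times the weight of [W]. *)
Lemma size_filter_le_weight {R : realType} {m : nat} {r : 'I_m -> R}
    (sigma t : R) (W : seq (seq 'I_m)) :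
  (forall i, 1 < `|r i|) -> 0 <= sigma ->
  (size [seq w <- W | `|slope r w| <= t])%:R <= t `^ sigma * weight r sigma W.
Proof.
move=> hr s0; elim: W => [|w W IH].
  by rewrite /= /weight big_nil mulr0.
rewrite /weight big_cons mulrDr /=; case: ifP => [wt|_]; last first.
  by rewrite -[X in X <= _]add0r lerD // mulr_ge0 // powR_ge0.
rewrite /= -natr1 addrC lerD //.
have w0 : 0 < `|slope r w| by rewrite normr_gt0 slope_neq0.
rewrite powRN ler_pdivlMr ?powR_gt0 // mul1r.
by rewrite ge0_ler_powR // nnegrE // ltW // (lt_le_trans w0).
Qed.

Lemma geometric_le {R : realType} (x : R) (n : nat) :
  0 <= x -> x < 1 -> \sum_(0 <= k < n) x ^+ k <= (1 - x)^-1.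
Proof.
move=> x0 x1; have x1' : 0 < 1 - x by rewrite subr_gt0.
rewrite -[leRHS]div1r ler_pdivlMr // big_mkord mulrC -opprB mulNr -subrX1 opprB.
by rewrite gerBl exprn_ge0.
Qed.

(** If every map of the semigroup is induced by some word of [A^k B], and the
    weight of [A] at [sigma] is less than [1], then the counting function is
    [O(t ^ sigma)]. *)
Lemma growth_count_le {R : realType} {m : nat} {r b : 'I_m -> R}
    (sigma t : R) (A B : seq (seq 'I_m)) :
  (forall i, 1 < `|r i|) -> 0 <= sigma -> weight r sigma A < 1 ->
  (forall w, exists k w', [/\ (k <= size w)%N, w' \in iter k (cat_words A) B &
     word_map (fun i => affine (r i) (b i)) w' =
     word_map (fun i => affine (r i) (b i)) w]) ->
  (growth_count (fun i => affine (r i) (b i)) t)%:R <=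
    weight r sigma B / (1 - weight r sigma A) * t `^ sigma.
Proof.
move=> hr s0 hA hAB.
(* only the terms with [k <= L] can have slope at most [t] *)
have [L hL] := size_le_of_slope_le t hr.
pose W := flatten [seq iter k (cat_words A) B | k <- index_iota 0 L.+1].
have WE : weight r sigma W <= weight r sigma B / (1 - weight r sigma A).
  rewrite /weight big_flatten big_map.
  under eq_bigr => k _ do rewrite -/(weight _ _ _) weight_iter.
  rewrite -mulr_suml mulrC; apply: ler_wpM2l; first exact: weight_ge0.
  by apply: geometric_le => //; apply: weight_ge0.
rewrite mulrC; apply: le_trans (ler_wpM2l (powR_ge0 _ _) WE).
apply: le_trans (size_filter_le_weight _ _ _ hr s0); rewrite ler_nat.
rewrite -(size_map (word_map (fun i => affine (r i) (b i)))).
apply: uniq_leq_size; first exact: fset_uniq.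
move=> g; rewrite in_fset_set ?inE; last exact: semigroup_ball_finite.
move=> /semigroup_ballP[w [w0 wt ->]].
have [k [w' [kw w'k ww']]] := hAB w; rewrite -ww'.
apply: map_f; rewrite mem_filter (slope_word_map ww') wt.
apply/flattenP; exists (iter k (cat_words A) B) => //.
by apply/mapP; exists k; rewrite // mem_index_iota /= ltnS (leq_trans kw) // hL.
Qed.

Lemma similarity_dim_nonempty {R : realType} {m : nat} {r : 'I_m -> R} {s : R} :
  is_similarity_dim r s -> (0 < m)%N.
Proof.
case: m r => // r; rewrite /is_similarity_dim big_ord0 => /esym/eqP.
by rewrite oner_eq0.
Qed.

(** The number [M t] of words of slope at most [t] in modulus satisfies
    [M t = 1 + \sum_i M (t / |r i|)] for [t >= 1], and [(t ^ s - 1) / m] is a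
    subsolution of this equation which is nonpositive for [t <= 1].  The bound
    [t <= rho ^ n] makes words of length at most [n] suffice. *)
Lemma size_filter_words_le_ge {R : realType} {m : nat} {r : 'I_m -> R}
    (s rho t : R) (n : nat) :
  (forall i, rho <= `|r i|) -> 1 < rho -> 0 <= s -> is_similarity_dim r s ->
  0 < t -> t <= rho ^+ n ->
  (t `^ s - 1) / m%:R <=
    (size [seq w <- words_le m n | `|slope r w| <= t])%:R.
Proof.
move=> hrho rho1 s0 hs; have m0 := similarity_dim_nonempty hs.
rewrite /is_similarity_dim in hs.
have m0' : 0 < m%:R :> R by rewrite ltr0n.
have r0 i : 0 < `|r i| by apply: lt_le_trans (hrho i); apply: lt_trans rho1.
have small t' (k : nat) : 0 < t' -> t' <= 1 -> (t' `^ s - 1) / m%:R <= k%:R.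
  move=> t0 t1; apply: (@le_trans _ _ 0) => //; rewrite pmulr_lle0 ?invr_gt0 //.
  rewrite subr_le0 -[leRHS](congr1 (@^~ s) (powR1 R)).
  by apply: ge0_ler_powR => //; rewrite nnegrE ltW.
elim: n t => [|n IH] t t0 tn; first exact: small.
have [t1|t1] := leP t 1; first exact: small.
have -> : (size [seq w <- words_le m n.+1 | `|slope r w| <= t])%:R =
  1 + \sum_(i < m)
        (size [seq w <- words_le m n | `|slope r w| <= t / `|r i|])%:R :> R.
  rewrite /words_le iterS /= /slope big_nil normr1 ltW //= -natr1 addrC.
  congr (1 + _); rewrite size_filter -sum1_count natr_sum.
  rewrite big_mkcond big_allpairs_dep /= big_map big_enum /=.
  apply: eq_bigr => i _; rewrite size_filter -sum1_count natr_sum.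
  rewrite [RHS]big_mkcond; apply: eq_bigr => w _.
  by rewrite big_cons normrM ler_pdivlMr // mulrC.
apply: (@le_trans _ _ (1 + \sum_(i < m) ((t / `|r i|) `^ s - 1) / m%:R)).
  rewrite -mulr_suml big_split /= sumrN sumr_const card_ord.
  have -> : \sum_(i < m) (t / `|r i|) `^ s = t `^ s.
    rewrite -[RHS]mulr1 -hs mulr_sumr; apply: eq_bigr => i _.
    rewrite powRM ?invr_ge0 ?(ltW t0) //; congr (_ * _).
    by rewrite -powR_inv1 // -powRrM mulN1r.
  rewrite !mulrBl divff ?gt_eqF // addrCA subrr addr0.
  by rewrite gerBl mul1r invr_ge0 ltW.
rewrite lerD2l; apply: ler_sum => i _; apply: IH.
  by rewrite divr_gt0.
rewrite ler_pdivrMr //; apply: le_trans tn _; rewrite exprSr.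
by apply: ler_wpM2l; rewrite // exprn_ge0 // ltW // (lt_trans _ rho1).
Qed.

(** * Logarithmic growth rates *)

Lemma near_pinfty_ln_ge {R : realType} (K : R) :
  \forall t \near +oo, K <= ln t.
Proof.
near=> t; have Kt : expR K <= t.
  by near: t; apply: nbhs_pinfty_ge; apply: num_real.
by rewrite -[K]expRK ler_ln // posrE ?expR_gt0 // (lt_le_trans (expR_gt0 K)).
Unshelve. all: by end_near. Qed.

(** If eventually [0 < N t <= C t ^ sigma], the logarithmic growth rate of [N]
    is at most [sigma], up to any [eta > 0]. *)
Lemma ln_ratio_le {R : realType} {N : R -> R} {C sigma eta : R} :
  0 < C -> 0 < eta ->
  (\forall t \near +oo, 0 < N t /\ N t <= C * t `^ sigma) ->
  \forall t \near +oo, ln (N t) / ln t <= sigma + eta.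
Proof.
move=> C0 e0 H; near=> t.
have t0 : 0 < t by near: t; apply: nbhs_pinfty_gt; apply: num_real.
have l1 : 1 <= ln t by near: t; apply: near_pinfty_ln_ge.
have lC : ln C / eta <= ln t by near: t; apply: near_pinfty_ln_ge.
have [N0 NC] : 0 < N t /\ N t <= C * t `^ sigma by near: t.
have ts : 0 < t `^ sigma by apply: powR_gt0.
rewrite ler_pdivrMr ?(lt_le_trans ltr01) // mulrDl addrC.
apply: (@le_trans _ _ (ln C + sigma * ln t)).
  by rewrite -ln_powR -lnM ?posrE // ler_ln ?posrE // mulr_gt0.
by rewrite lerD2r mulrC -ler_pdivrMr.
Unshelve. all: by end_near. Qed.

Lemma ln_ratio_ge {R : realType} {N : R -> R} {c sigma eta : R} :
  0 < c -> 0 < eta ->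
  (\forall t \near +oo, c * t `^ sigma <= N t) ->
  \forall t \near +oo, sigma - eta <= ln (N t) / ln t.
Proof.
move=> c0 e0 H; near=> t.
have t0 : 0 < t by near: t; apply: nbhs_pinfty_gt; apply: num_real.
have l1 : 1 <= ln t by near: t; apply: near_pinfty_ln_ge.
have lc : - ln c / eta <= ln t by near: t; apply: near_pinfty_ln_ge.
have Nc : c * t `^ sigma <= N t by near: t.
have ts : 0 < t `^ sigma by apply: powR_gt0.
rewrite ler_pdivlMr ?(lt_le_trans ltr01) // mulrBl.
apply: (@le_trans _ _ (ln c + sigma * ln t)).
  by rewrite addrC lerD2r lerNl mulrC -ler_pdivrMr.
have cts : 0 < c * t `^ sigma by rewrite mulr_gt0.
by rewrite -ln_powR -lnM ?posrE // ler_ln ?posrE // (lt_le_trans cts).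
Unshelve. all: by end_near. Qed.

(** * The similarity dimension *)

Lemma similarity_dim_ge0 {R : realType} {m : nat} {r : 'I_m -> R} {s : R} :
  (forall i, 1 < `|r i|) -> is_similarity_dim r s -> 0 <= s.
Proof.
move=> hr hs; rewrite leNgt; apply/negP => s0.
have m0 := similarity_dim_nonempty hs.
move: hs; rewrite /is_similarity_dim (bigD1 (Ordinal m0)) //= => hs.
suff : 1 < `|r (Ordinal m0)| `^ (- s).
  rewrite -[ltLHS]hs gtrDl ltNge sumr_ge0 // => i _; exact: powR_ge0.
rewrite -[ltLHS](congr1 (@^~ (- s)) (powR1 R)).
apply: gt0_ltr_powR => //; rewrite ?oppr_gt0 // nnegrE //.
Qed.

Lemma weight_letters_lt1 {R : realType} {m : nat} {r : 'I_m -> R}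
    {s sigma : R} :
  (forall i, 1 < `|r i|) -> is_similarity_dim r s -> s < sigma ->
  weight r sigma (letters m) < 1.
Proof.
move=> hr hs ss; rewrite weight_letters -[ltRHS]hs.
have m0 := similarity_dim_nonempty hs.
apply: ltr_sum => [|i _].
  by apply/hasP; exists (Ordinal m0); rewrite ?mem_index_enum.
have r0 : 0 < `|r i| by apply: lt_trans (hr i).
rewrite /powR (gt_eqF r0) ltr_expR ltr_pM2r ?ln_gt0 //.
by rewrite ltrN2.
Qed.

(** * Exact overlaps *)

(** Without exact overlaps distinct words have distinct maps. *)
Lemma no_overlap_inj {R : realType} {m : nat} {r b : 'I_m -> R}
    {u v : seq 'I_m} :
  ~ dual_exact_overlaps (fun i => affine (r i) (b i)) ->
  u <> [::] -> v <> [::] ->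
  word_map (fun i => affine (r i) (b i)) u =
    word_map (fun i => affine (r i) (b i)) v -> u = v.
Proof.
move=> nov u0 v0 E; apply/eqP/negPn/negP => /eqP uv.
by apply: nov; exists u, v; split => //; rewrite E.
Qed.

(** Two distinct words with the same map yield two of the same length: strip
    the common prefix to get [u] and [v] with distinct first letters, and
    compare [uv] with [vu].  A proper prefix never has the same map, since a
    nonempty word has slope greater than [1] in modulus. *)
Lemma same_length_overlap {R : realType} {m : nat} {r b : 'I_m -> R}
    {u v : seq 'I_m} :
  (forall i, 1 < `|r i|) -> u <> v ->
  word_map (fun i => affine (r i) (b i)) u =
    word_map (fun i => affine (r i) (b i)) v ->
  exists u' v', [/\ size u' = size v', u' <> v' &
    word_map (fun i => affine (r i) (b i)) u' =
    word_map (fun i => affine (r i) (b i)) v'].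
Proof.
move=> hr; set f := fun i => affine (r i) (b i).
have nil_ne w : w <> [::] -> word_map f [::] <> word_map f w.
  move=> w0 /slope_word_map E; have := slope_gt1 w hr w0.
  by rewrite -E /slope big_nil normr1 ltxx.
elim: u v => [|i u IH] [|j v] // uv E.
- by case: (nil_ne (j :: v)).
- by case: (nil_ne (i :: u)).
have [ij|ij] := eqVneq i j; last first.
  exists ((i :: u) ++ (j :: v)), ((j :: v) ++ (i :: u)); split.
  - by rewrite !size_cat addnC.
  - by case=> /eqP; rewrite (negPf ij).
  - by rewrite !word_map_cat E.
apply: (IH v) => [uv'|]; first by apply: uv; rewrite ij uv'.
apply/funext => x; have := congr1 (@^~ x) E; rewrite /= -ij.
apply: bij_inj; apply: affine_bij.
by rewrite -normr_gt0; apply: lt_trans (hr i).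
Qed.

(** If [u] and [v] have the same length [n] and the same map, every map is
    induced by a concatenation of [n]-letter blocks other than [u], followed
    by a word of length at most [n]. *)
Lemma block_representation {T : Type} {m : nat} {f : 'I_m -> T -> T}
    {u v : seq 'I_m} (w : seq 'I_m) :
  size u = size v -> u <> v -> word_map f u = word_map f v ->
  exists k w', [/\ (k <= size w)%N,
    w' \in iter k (cat_words (rem u (words_eq m (size u))))
                  (words_le m (size u)) &
    word_map f w' = word_map f w].
Proof.
move=> uv_size uv E; have [n] := ubnP (size w).
have u0 : (0 < size u)%N.
  by case: u uv_size uv {E} => //= /esym/size0nil ->.
elim: n w => // n IH w; rewrite ltnS => wn.
have [wu|wu] := leqP (size w) (size u).
  by exists 0, w; split; rewrite //= mem_words_le.
have [k [w' [kw w'k Ew]]] : exists k w', [/\ (k <= size (drop (size u) w))%N,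
    w' \in iter k (cat_words (rem u (words_eq m (size u))))
                  (words_le m (size u)) &
    word_map f w' = word_map f (drop (size u) w)].
  by apply: IH; rewrite size_drop; lia.
pose a := if take (size u) w == u then v else take (size u) w.
exists k.+1, (a ++ w'); split.
- by move: kw; rewrite size_drop; lia.
- rewrite iterS; apply: allpairs_f => //; rewrite /a.
  case: eqVneq => [_|tu]; apply: rem_mem => //.
  + by apply/eqP => /esym.
  + by rewrite mem_words_eq uv_size.
  + by rewrite mem_words_eq size_take wu.
- rewrite -[in RHS](cat_take_drop (size u) w) !word_map_cat Ew /a.
  by case: eqP => // ->; rewrite E.
Qed.

(** Deleting one of two distinct equal-length words brings the weight at the
    similarity dimension strictly below [1], hence, by continuity, also at
    some smaller exponent. *)
Lemma exists_smaller_exponent {R : realType} {m : nat} {r : 'I_m -> R}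
    {s : R} {u v : seq 'I_m} :
  (forall i, 1 < `|r i|) -> is_similarity_dim r s ->
  size u = size v -> u <> v ->
  0 < s /\ exists sigma, [/\ 0 <= sigma, sigma < s &
    weight r sigma (rem u (words_eq m (size u))) < 1].
Proof.
move=> hr hs uv_size uv; have s0 := similarity_dim_ge0 hr hs.
set A := rem _ _.
have wA : weight r s A = 1 - `|slope r u| `^ (- s).
  rewrite weight_rem ?mem_words_eq // weight_words_eq weight_letters.
  by rewrite (hs : \sum_i _ = 1) expr1n.
have A1 : weight r s A < 1.
  by rewrite wA ltrBlDr ltrDl powR_gt0 // normr_gt0 slope_neq0.
have vA : v \in A.
  by apply: rem_mem; rewrite ?mem_words_eq ?uv_size //; apply/eqP => /esym.
have sgt0 : 0 < s.
  rewrite lt_neqAle s0 andbT; apply/eqP => s0'.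
  (* at exponent [0] the word [v] alone has weight [1] *)
  have := weight_mem r s A v vA.
  by rewrite -s0' oppr0 powRr0 leNgt s0' A1.
split=> //.
have : \forall x \near s, weight r x A < 1.
  exact: cvgr_lt (weight_continuous r A hr s) _ A1.
move=> /nbhs_ballP[e /= e0 He].
exists (Num.max 0 (s - e / 2)); split.
- by rewrite le_max lexx.
- by rewrite gt_max sgt0 /= gtrBl divr_gt0.
- apply: He; rewrite /ball /=.
  rewrite ger0_norm ?subr_ge0 ?ge_max ?s0 /=; last first.
    by rewrite gerBl divr_ge0 // ltW.
  rewrite ltrBlDr -ltrBlDl lt_max; apply/orP; right.
  by rewrite ltrD2l ltrN2 ltr_pdivrMr // ltr_pMr // ltr1n.
Qed.

Theorem proposition4p13 (R : realType) (m : nat) (r b : 'I_m -> R)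
    (f := fun i : 'I_m => affine (r i) (b i))
    (hr : forall i : 'I_m, 1 < `|r i|)
    (hf : injective f)
    (s : R) (hs : is_similarity_dim r s) :
  growth_dim f = s <-> ~ dual_exact_overlaps f.
Proof.
have s0 := similarity_dim_ge0 hr hs.
have m0 := similarity_dim_nonempty hs.
pose i0 := Ordinal m0.
have N1 : \forall t \near +oo, 1 <= (growth_count f t)%:R :> R.
  near=> t; rewrite ler1n; have it : `|r i0| <= t.
    by near: t; apply: nbhs_pinfty_ge; apply: num_real.
  exact: growth_count_gt0 hr it.
split=> [dim_s [u0 [v0 [_ _ uv0 /pinv_bij_inj E0]]]|nov].
  (* the maps are bijective, so an overlap of inverses is one of maps *)
  have {}E0 : word_map f u0 = word_map f v0 by apply: E0; apply: word_map_bij.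
  have [u [v [uv_size uv E]]] := same_length_overlap hr uv0 E0.
  have [spos [sigma [sig0 sig_s wA]]] :=
    exists_smaller_exponent hr hs uv_size uv.
  set A := rem _ _ in wA.
  pose B := words_le m (size u).
  (* the summand [1] only makes the constant visibly positive *)
  pose C := weight r sigma B / (1 - weight r sigma A) + 1.
  have C0 : 0 < C.
    by rewrite ltr_wpDl // divr_ge0 ?weight_ge0 // subr_ge0 ltW.
  pose eta := (s - sigma) / 2.
  have e0 : 0 < eta by rewrite divr_gt0 // subr_gt0.
  have : \forall t \near +oo, ln (growth_count f t)%:R / ln t <= sigma + eta.
    apply: (ln_ratio_le C0 e0); near=> t; split.
      by apply: (@lt_le_trans _ _ 1) => //; near: t.
    have := growth_count_le (b := b) sigma t A B hr sig0 wA
      (fun w => block_representation w uv_size uv E).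
    move=> /le_trans; apply; rewrite ler_wpM2r ?powR_ge0 //.
    by rewrite /C lerDl.
  (* a divergent filter would have [lim] equal to [0], but [0 < s] *)
  have cv : cvg ((ln (growth_count f t)%:R / ln t)%R @[t --> +oo%R])%classic.
    by apply: cvgNpoint; rewrite -/(growth_dim f) dim_s gt_eqF.
  move=> /(limr_le cv); rewrite -/(growth_dim f) dim_s /eta; lra.
apply: cvg_lim => //; apply/cvgrPdist_le => eta e0.
near=> t; rewrite ler_distlC; apply/andP; split; near: t.
  (* with [N] the counting function, [t ^ s - 1 <= m (N + 1)] and [N >= 1]
     give [t ^ s <= 3 m N] *)
  apply: (@ln_ratio_ge _ _ (3 * m%:R)^-1) => //.
    by rewrite invr_gt0 mulr_gt0 // ltr0n.
  have [rho rho1 hrho] := exists_expansion hr.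
  near=> t.
  have t0 : 0 < t by near: t; apply: nbhs_pinfty_gt; apply: num_real.
  have [n tn] := exists_expr_ge rho t rho1.
  have := size_filter_words_le_ge s rho t n hrho rho1 s0 hs t0 tn.
  set W := [seq w <- _ | _].
  (* [W] may contain the empty word, which the semigroup excludes *)
  have WN : (size W <= (growth_count f t).+1)%N.
    have uW : uniq W by rewrite filter_uniq // uniq_words_le.
    have sz : (size W <= (size (rem [::] W)).+1)%N.
      have [W0|W0] := boolP ([::] \in W); last by rewrite rem_id.
      by rewrite size_rem // leqSpred.
    apply: leq_trans sz _; rewrite ltnS.
    apply: growth_count_ge_size => //; first exact: rem_uniq.
      move=> w; rewrite mem_rem_uniq // !inE mem_filter => /andP[/eqP w0].
      by case/andP.
    move=> x y; rewrite !mem_rem_uniq // !inE.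
    move=> /andP[/eqP x0 _] /andP[/eqP y0 _]; exact: no_overlap_inj.
  have {}WN : (size W)%:R <= (growth_count f t)%:R + 1 :> R.
    by rewrite natr1 ler_nat.
  have gN : 1 <= (growth_count f t)%:R :> R by near: t.
  have m1 : 1 <= m%:R :> R by rewrite ler1n.
  rewrite ler_pdivrMr ?ltr0n // => Wt.
  rewrite mulrC ler_pdivrMr ?mulr_gt0 ?ltr0n //.
  nra.
have e2 : 0 < eta / 2 by rewrite divr_gt0.
have w1 : weight r (s + eta / 2) (letters m) < 1.
  by apply: weight_letters_lt1 hr hs _; rewrite ltrDl.
pose C := weight r (s + eta / 2) [:: [::]] /
          (1 - weight r (s + eta / 2) (letters m)).
have C0 : 0 < C.
  by rewrite divr_gt0 ?subr_gt0 // /weight big_seq1 /slope big_nil normr1 powR1.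
rewrite [eta in s + eta]splitr addrA.
apply: (ln_ratio_le C0 e2); near=> t; split.
  by apply: (@lt_le_trans _ _ 1) => //; near: t.
apply: growth_count_le => //; first by rewrite addr_ge0 // ltW.
by move=> w; exists (size w), w; split; rewrite // mem_words_eq.
Unshelve. all: by end_near. Qed.
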